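(* Let $n\ge1$ and $k\ge1$ be integers. The element $(x_k)^{-1}$ in type $C_n$ is the probability distribution of the signed permutation produced by the following shuffle. Step 1: Start with a deck of $n$ cards face down. Choose $k$ numbers $j_1,\dots,j_k$ multinomially, with the probability of getting $j_1,\dots,j_k$ equal to $\binom{n}{j_1,\dots,j_k}/k^n$. Make $k$ stacks of cards of sizes $j_1,\dots,j_k$ respectively. If $k$ is odd, flip over the even numbered stacks. If $k$ is even, flip over the odd numbered stacks. Step 2: Drop cards from packets with probability proportional to packet size at a given time. Equivalently, choose uniformly at random one of the $\binom{n}{j_1,\dots,j_k}$ interleavings of the packets.
   Context: $C_n$ also denotes the Weyl group of type $C_n$: the hyperoctahedral group of signed permutations $w$ of $\{\pm1,\dots,\pm n\}$ ($w(-i)=-w(i)$), acting on $\mathbb{R}^n$ by $w e_i=\mathrm{sgn}(w(i))e_{|w(i)|}$. Positive roots: $e_i\pm e_j$ ($i<j$) and $2e_i$; simple roots $\alpha_i=e_i-e_{i+1}$ ($1\le i\le n-1$), $\alpha_n=2e_n$; highest root $\theta=2e_1$ and $\alpha_0=-\theta$; coroot lattice $Y=\mathbb{Z}^n$ with the standard pairing $\langle\ ,\ \rangle$. Put $\Pi=\{\alpha_1,\dots,\alpha_n\}$ and $\tilde\Pi=\Pi\cup\{\alpha_0\}$, and let $Cdes(w)$ be the set of elements of $\tilde\Pi$ mapped to negative roots by $w$. Cellini's element: for a positive integer $k$ and $I\subseteq\tilde\Pi$, let $a_{k,I}$ be the number of $t\in Y$ with $\langle\alpha_i,t\rangle=0$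 for $\alpha_i\in I\cap\Pi$, $\langle\alpha_i,t\rangle>0$ for $\alpha_i\in\Pi\setminus I$, and $\langle\theta,t\rangle=k$ if $\alpha_0\in I$, $\langle\theta,t\rangle<k$ if $\alpha_0\notin I$. Then $x_k$ is the element of the rational group algebra of $C_n$ in which the coefficient of $w$ is $\frac{1}{k^n}\sum_{I\subseteq\tilde\Pi\setminus Cdes(w)}a_{k,I}$. If $x_k=\sum_w c_w w$, then $(x_k)^{-1}$ denotes $\sum_w c_w w^{-1}$. Conventions: initially card $i$ is in position $i$ from the top, face down. Stack $1$ consists of the top $j_1$ cards, stack $2$ of the next $j_2$ cards, and so on. Flipping over a stack reverses the order of its cards and turns each of them face up. Interleavings preserve the relative order of cards within each packet. The signed permutation $w$ produced is such that card $|w(i)|$ is in position $i$ from the top after the shuffle, with $w(i)>0$ if that card is face down and $w(i)<0$ if it is face up. The statement means that for each $w$ the coefficient of $w$ in $(x_k)^{-1}$ is the probability that the shuffle produces $w$. *)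

(* Defs.v *)
From HB Require Import structures.
From mathcomp Require Import all_boot all_order all_algebra all_fingroup.
From mathcomp Require Import finmap boolp classical_sets cardinality.

Set Implicit Arguments.
Unset Strict Implicit.
Unset Printing Implicit Defensive.

Import GRing.Theory Num.Theory.
Local Open Scope ring_scope.

(* The set {±1, ..., ±n}: (i, false) stands for +(i+1), (i, true) for -(i+1).
   It also serves as the set of card states: (i, b) is card i+1, face up
   exactly when b is true. *)
Definition signed (n : nat) : finType := ('I_n * bool)%type.

Definition neg (n : nat) (x : signed n) : signed n := (x.1, ~~ x.2).

Definition hyperoct_set (n : nat) : {set {perm signed n}} :=
  [set w : {perm signed n} | [forall x : signed n, w (neg x) == neg (w x)]].

Lemma hyperoct_group_set (n : nat) : group_set (hyperoct_set n).
Proof.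
apply/group_setP; split=> [|u v].
  by rewrite inE; apply/forallP=> x; rewrite !perm1.
rewrite !inE => /forallP hu /forallP hv; apply/forallP=> x.
by rewrite !permM (eqP (hu x)) (eqP (hv (u x))).
Qed.

Definition hyperoct (n : nat) : {group {perm signed n}} :=
  Group (hyperoct_group_set n).

(* The Weyl group C_n as a type. *)
Definition weylC (n : nat) : finGroupType := subg_of (hyperoct n).

Definition wapply (n : nat) (w : weylC n) (x : signed n) : signed n :=
  sgval w x.

(* Roots, coroots and the action all live in Z^n inside R^n.  The basis is
   numbered from 1: [ebasis n i] is e_i for 1 <= i <= n. *)
Definition ebasis (n i : nat) : 'rV[int]_n := \row_(j < n) (j.+1 == i)%:R.

Definition signed_vec (n : nat) (x : signed n) : 'rV[int]_n :=
  (-1) ^+ x.2 *: ebasis n x.1.+1.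

Definition wact (n : nat) (w : weylC n) (v : 'rV[int]_n) : 'rV[int]_n :=
  \sum_(i < n) v 0 i *: signed_vec (wapply w (i, false)).

Definition pairing (n : nat) (u v : 'rV[int]_n) : int :=
  \sum_(i < n) u 0 i * v 0 i.

Definition positive_root (n : nat) (v : 'rV[int]_n) : bool :=
  [exists i : 'I_n, v == ebasis n i.+1 *+ 2] ||
  [exists i : 'I_n, exists j : 'I_n,
     (i < j)%N && ((v == ebasis n i.+1 + ebasis n j.+1) ||
                   (v == ebasis n i.+1 - ebasis n j.+1))].

Definition negative_root (n : nat) (v : 'rV[int]_n) : bool :=
  positive_root (- v).

Definition theta (n : nat) : 'rV[int]_n := ebasis n 1 *+ 2.

Definition alpha (n : nat) (i : 'I_n.+1) : 'rV[int]_n :=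
  if val i == 0%N then - theta n
  else if val i == n then ebasis n n *+ 2
  else ebasis n i - ebasis n i.+1.

(* Subsets of the extended simple system are given by sets of indices in
   {0, ..., n}; for n >= 1 the vectors alpha_0, ..., alpha_n are distinct. *)
Definition Cdes (n : nat) (w : weylC n) : {set 'I_n.+1} :=
  [set i | negative_root (wact w (alpha i))].

Definition cellini_points (n k : nat) (I : {set 'I_n.+1}) : set 'rV[int]_n :=
  [set t | (forall i : 'I_n.+1, i != ord0 ->
              if i \in I then pairing (alpha i) t = 0
              else 0 < pairing (alpha i) t)
         /\ (if ord0 \in I then pairing (theta n) t = k%:Z
             else pairing (theta n) t < k%:Z)]%classic.

(* For n >= 1 the conditions force k/2 >= t_1 >= ... >= t_n >= 0, so the set is
   finite and [fset_set] is not used on its junk case. *)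
Definition cellini_a (n k : nat) (I : {set 'I_n.+1}) : nat :=
  #|` fset_set (cellini_points k I) |%fset.

(* Elements of the rational group algebra of C_n, as coefficient functions. *)
Definition group_algebra (n : nat) : Type := {ffun weylC n -> rat}.

Definition cellini_x (n k : nat) : group_algebra n :=
  [ffun w => (k%:R ^+ n)^-1 *
     \sum_(I : {set 'I_n.+1} | I \subset ~: Cdes w) (cellini_a k I)%:R].

(* \sum_w c_w w^-1, whose coefficient at w is c_(w^-1) *)
Definition ga_inv (n : nat) (x : group_algebra n) : group_algebra n :=
  [ffun w => x (w^-1)%g].

(* Decks and stacks are listed from top to bottom. *)
Definition deck (n : nat) : Type := seq (signed n).

Definition initial_deck (n : nat) : deck n := [seq (i, false) | i <- enum 'I_n].

Definition flip (n : nat) (s : deck n) : deck n := rev (map (@neg n) s).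

(* [i] is the number of the stack, counted from 1. *)
Definition flipped (k i : nat) : bool := if odd k then ~~ odd i else odd i.

(* The packets obtained from the initial deck with stack sizes [js]. *)
Definition packets (n : nat) (js : seq nat) : seq (deck n) :=
  let stacks := reshape js (initial_deck n) in
  [seq (let s := nth [::] stacks i in
        if flipped (size js) i.+1 then flip s else s) | i <- iota 0 (size js)].

Definition multinomial_prob (n k : nat) (js : seq nat) : rat :=
  n`!%:R / (\prod_(j <- js) j`!)%:R / k%:R ^+ n.

(* As the cards are distinct, an interleaving is determined by the resulting
   deck. *)
Definition interleaving (n : nat) (ps : seq (deck n)) (d : deck n) : bool :=
  perm_eq d (flatten ps) && all (fun p => subseq p d) ps.

(* Probability of the deck [d] under a uniformly random interleaving. *)
Definition uniform_riffle (n : nat) (ps : seq (deck n)) (d : deck n) : rat :=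
  if interleaving ps d
  then (#|[set t : n.-tuple (signed n) | interleaving ps t]|%:R)^-1 else 0.

(* Probability that dropping the cards one at a time, each time the bottom card
   of packet i with probability (size of packet i) / (number of cards left),
   yields the successive cards [r]. *)
Fixpoint drop_prob (n : nat) (ps : seq (deck n)) (r : seq (signed n)) : rat :=
  if r is c :: r' then
    \sum_(i < size ps)
      let p := nth [::] ps i in
      if ohead (rev p) == Some c then
        (size p)%:R / (sumn (shape ps))%:R *
        drop_prob (set_nth [::] ps i (take (size p).-1 p)) r'
      else 0
  else (all (@nilp (signed n)) ps)%:R.

(* The first card dropped ends up at the bottom of the deck. *)
Definition drop_riffle (n : nat) (ps : seq (deck n)) (d : deck n) : rat :=
  drop_prob ps (rev d).

(* The deck corresponding to w: card |w(i)| in position i, face up iff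
   w(i) < 0. *)
Definition deck_of (n : nat) (w : weylC n) : deck n :=
  [seq wapply w (i, false) | i <- enum 'I_n].

(* Probability that the shuffle produces w, [riffle ps d] being the probability
   that its second step turns the packets [ps] into the deck [d]. *)
Definition shuffle_prob (n k : nat)
    (riffle : seq (deck n) -> deck n -> rat) (w : weylC n) : rat :=
  \sum_(j : k.-tuple 'I_n.+1 | sumn (map val j) == n)
     multinomial_prob n k (map val j) *
     riffle (packets n (map val j)) (deck_of w).

(* Main.v *)
Require Import Defs.
From mathcomp Require Import all_boot all_order all_algebra all_fingroup.
From mathcomp Require Import finmap classical_sets cardinality.
From mathcomp Require Import zify.

(** Write u = w^-1, which sends card c to its position in the shuffled deck,
    with a minus sign when the card is face up.  Multiplied by k^n, the two
    sides of the identity count two finite sets, and these are in bijection.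

    On the shuffle side, every interleaving of given packets has the same
    probability under either form of the second step.  For dropping cards this
    is a telescoping product: the chosen packet contributes its size to the
    numerator, the deck its size to the denominator, whatever the order of the
    drops (drop_probE).  Hence both forms give the inverse of the number of
    interleavings, prod j_i! / n!, which cancels the multinomial coefficient,
    and k^n times the probability of w is the number of stack sizes
    (j_1, ..., j_k) for which the deck of w is an interleaving of the packets
    (shuffle_probE).

    On the algebra side, the sum of the a_(k,I) over the I that miss the cyclic
    descents of u counts the lattice points of the closed alcove dilated by k
    that lie on no wall indexed by a cyclic descent of u (cellini_xE).

    The bijection passes through the labelling f that gives to card c the index
    f(c) in {0, ..., k-1} of its stack.  The rule for flipping stacks says
    exactly that stack i is flipped when k-1-i is odd.  So, with b(c) = 1 if
    u(c) is negative and 0 otherwise, compatible labellings have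
    k-1-f(c) = b(c) modulo 2, and the lattice point is defined by
    2 t(c) = k-1-f(c) + b(c).  Each value of t thus stands for at most two
    consecutive stacks, one flipped and one not, and the signs of u tell them
    apart.  The
    walls translate as follows: the bounds 0 <= f <= k-1 become the two
    end walls with their strictness (above_walls_alcove_point,
    alcove_point_onto), and t(c) >= t(c+1), strict at descents, becomes
    f(c) <= f(c+1), strict at descents.  The latter condition says that within
    a stack the positions of the cards increase, or decrease if the stack was
    flipped, which is what being an interleaving means (interleavingP,
    compatible_labelsP). *)

Set Implicit Arguments.
Unset Strict Implicit.
Unset Printing Implicit Defensive.

Import Order.TTheory GRing.Theory Num.Theory.
Local Open Scope ring_scope.

(** * The two riffles agree *)

Lemma uniq_flatten_nth (T : eqType) (ss : seq (seq T)) (x : T) (i j : nat) :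
  uniq (flatten ss) -> x \in nth [::] ss i -> x \in nth [::] ss j -> i = j.
Proof.
elim: ss i j => [|s ss IH] i j /=; first by rewrite nth_nil.
rewrite cat_uniq => /and3P[_ /hasPn dis U].
have out l : x \in nth [::] ss l -> x \notin s.
  move=> xl; apply: dis; apply/flattenP; exists (nth [::] ss l) => //.
  by apply: mem_nth; case: ltnP xl => // /(nth_default [::]) ->.
case: i j => [|i] [|j] //=.
- by move=> xs /out; rewrite xs.
- by move=> /out /negP xs /xs.
- by move=> xi xj; rewrite (IH i j).
Qed.

Lemma subseq_rcons2 (T : eqType) (s t : seq T) (x y : T) :
  subseq (rcons s x) (rcons t y) =
  if x == y then subseq s t else subseq (rcons s x) t.
Proof.
rewrite -subseq_rev !rev_rcons /=; case: (x == y); first by rewrite subseq_rev.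
by rewrite -rev_rcons subseq_rev.
Qed.

Lemma subseq_rcons_notin (T : eqType) (s t : seq T) (y : T) :
  y \notin s -> subseq s (rcons t y) = subseq s t.
Proof.
case/lastP: s => [|s x]; first by rewrite !sub0seq.
by rewrite mem_rcons inE negb_or eq_sym subseq_rcons2 => /andP[/negPf -> _].
Qed.

(** The first card dropped is the bottom one of the final deck, so removing it
    from the deck and from its packet is what makes the induction on drops
    work; uniqueness keeps the card out of the other packets. *)
Lemma interleaving_rcons (n : nat) (ps1 ps2 : seq (deck n)) (q d : deck n) c :
  uniq (flatten (ps1 ++ rcons q c :: ps2)) ->
  interleaving (ps1 ++ rcons q c :: ps2) (rcons d c) =
  interleaving (ps1 ++ q :: ps2) d.
Proof.
rewrite /interleaving !flatten_cat /= cat_rcons => U.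
have out ps : {subset ps <= ps1 ++ ps2} ->
    all (fun p => subseq p (rcons d c)) ps = all (fun p => subseq p d) ps.
  move=> sub; apply: eq_in_all => p /sub p_in.
  rewrite subseq_rcons_notin //; apply: contraL U => cp.
  have cin : c \in flatten ps1 ++ flatten ps2.
    by rewrite -flatten_cat; apply/flattenP; exists p.
  have -> : flatten ps1 ++ q ++ c :: flatten ps2 =
            (flatten ps1 ++ q) ++ c :: flatten ps2 by rewrite -catA.
  rewrite uniq_catC /= mem_cat negb_and.
  by move: cin; rewrite !mem_cat => /orP[] ->; rewrite ?orbT.
rewrite !all_cat /= !out; last first.
- by move=> p; rewrite mem_cat => ->.
- by move=> p; rewrite mem_cat => ->; rewrite orbT.
rewrite subseq_rcons2 eqxx; congr (_ && _).
have pull : perm_eq (flatten ps1 ++ q ++ c :: flatten ps2)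
                    (c :: flatten ps1 ++ q ++ flatten ps2).
  by rewrite catA -cat1s perm_catCA /= -catA.
by rewrite perm_rcons (permPr pull) perm_cons.
Qed.

Lemma nth_split (T : Type) (x0 : T) (s : seq T) (i : nat) :
  (i < size s)%N -> s = take i s ++ nth x0 s i :: drop i.+1 s.
Proof. by move=> lt_i; rewrite -drop_nth // cat_take_drop. Qed.

Lemma set_nth_split (T : Type) (x0 y : T) (s : seq T) (i : nat) :
  (i < size s)%N -> set_nth x0 s i y = take i s ++ y :: drop i.+1 s.
Proof. by elim: s i => [|x s IH] [|i] //= lt_i; rewrite ?drop0 ?IH. Qed.

Lemma last_card (T : Type) (s : seq T) (x : T) :
  ohead (rev s) = Some x -> s = rcons (take (size s).-1 s) x.
Proof.
case/lastP: s => [|s y] //; rewrite rev_rcons size_rcons /= => -[->].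
by rewrite -cats1 take_size_cat // cats1.
Qed.

(** The bottom card of an interleaving must come from the bottom of its packet:
    otherwise the card below it in the packet would lie below it in the deck. *)
Lemma last_packet (n : nat) (ps : seq (deck n)) (d : deck n) (c : signed n) :
  uniq (flatten ps) -> interleaving ps (rcons d c) ->
  exists i : 'I_(size ps), ohead (rev (nth [::] ps i)) == Some c.
Proof.
move=> U /andP[pe /allP sub].
have Ud : uniq (rcons d c) by rewrite (perm_uniq pe).
have : c \in flatten ps by rewrite -(perm_mem pe) mem_rcons mem_head.
case/flattenP=> p p_in; have /(nthP [::])[i lt_i <-] := p_in.
move=> c_in; exists (Ordinal lt_i) => /=.
have := sub _ (mem_nth [::] lt_i); move: c_in.
case/lastP: (nth _ _ _) => [|q x] // c_in.
rewrite rev_rcons subseq_rcons2 /=; case: eqP => [-> //|_].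
move=> /mem_subseq/(_ _ c_in) cd.
by move: Ud; rewrite rcons_uniq cd.
Qed.

(** Each drop multiplies the probability by the size of the packet over the
    size of the remaining deck; over a whole shuffle these factors make up a
    product of factorials that does not depend on the order of the drops. *)
Lemma drop_probE (n : nat) (ps : seq (deck n)) (r : seq (signed n)) :
  uniq (flatten ps) ->
  drop_prob ps r =
  if interleaving ps (rev r)
  then (\prod_(p <- ps) (size p)`!)%:R / (size (flatten ps))`!%:R else 0.
Proof.
elim: r ps => [|c r IH] ps U /=.
  rewrite /interleaving /= perm_sym.
  have -> : perm_eq (flatten ps) [::] = all (@nilp (signed n)) ps.
    have -> : perm_eq (flatten ps) [::] = nilp (flatten ps).
      by apply/idP/idP => [/perm_size/eqP|/nilP ->].
    by elim: ps {U} => //= p ps <-; rewrite /nilp size_cat addn_eq0.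
  have [/allP nil_ps|//] := boolP (all _ ps).
  have -> : all (fun p => subseq p [::]) ps.
    by apply/allP=> p /nil_ps /nilP ->.
  rewrite big1_seq => [|p /andP[_ /nil_ps /nilP ->] //].
  rewrite size_flatten sumnE big_map big1_seq => [|p /andP[_ /nil_ps /nilP ->] //].
  by rewrite divr1.
rewrite rev_cons.
case: (pickP (fun i : 'I_(size ps) => ohead (rev (nth [::] ps i)) == Some c)).
  move=> i last_i; rewrite (bigD1 i) //= last_i big1 ?addr0; last first.
    move=> j neq_ji; case: ifP => // last_j; case/eqP: neq_ji.
    apply: val_inj => /=; apply: (uniq_flatten_nth (x := c) U).
      by rewrite (last_card (eqP last_j)) mem_rcons mem_head.
    by rewrite (last_card (eqP last_i)) mem_rcons mem_head.
  have := last_card (eqP last_i); move: (take _.-1 _) => q def_q.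
  have split_ps := nth_split [::] (ltn_ord i); rewrite def_q in split_ps.
  rewrite set_nth_split //.
  move: (take i ps) (drop i.+1 ps) split_ps => ps1 ps2 split_ps.
  rewrite IH; last first.
    move: U; rewrite split_ps !flatten_cat /=.
    apply: subseq_uniq; apply: cat_subseq => //.
    by apply: cat_subseq => //; apply: subseq_rcons.
  rewrite def_q -size_flatten split_ps interleaving_rcons -?split_ps //.
  case: ifP => _; last by rewrite mulr0.
  rewrite split_ps !big_cat /= !big_cons !flatten_cat /= !size_cat size_rcons.
  rewrite addSn addnS !factS !natrM invfM mulrACA.
  by congr (_ * _); rewrite mulrCA !mulrA.
move=> none; rewrite big1 => [|i _]; last by rewrite none.
case: ifP => // /(last_packet U)[i]; rewrite none //.
Qed.

Lemma big_tuple_cons (R : nmodType) (T : finType) (m : nat) (F : seq T -> R) :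
  \sum_(t : m.+1.-tuple T) F t = \sum_(c : T) \sum_(t : m.-tuple T) F (c :: t).
Proof.
rewrite pair_big /=.
rewrite (reindex (fun x : T * m.-tuple T => [tuple of x.1 :: x.2])) //.
exists (fun t : m.+1.-tuple T => (thead t, [tuple of behead t])) => [[c t] _|t _] /=.
  by rewrite theadE; congr (_, _); apply: val_inj.
by rewrite [RHS]tuple_eta.
Qed.

(** At each step the probabilities of the nonempty packets add up to 1.  This
    is used to count interleavings without a bijection. *)
Lemma sum_drop_prob (n m : nat) (ps : seq (deck n)) :
  size (flatten ps) = m -> \sum_(t : m.-tuple (signed n)) drop_prob ps t = 1.
Proof.
elim: m ps => [|m IH] ps sz.
  have nil_ps : all (@nilp (signed n)) ps.
    move/eqP: sz; elim: ps => //= p ps IHp.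
    by rewrite size_cat addn_eq0 /nilp => /andP[-> /IHp].
  rewrite (eq_bigr (fun _ => 1)) => [|t _]; last by rewrite tuple0 /= nil_ps.
  by rewrite sumr_const card_tuple expn0.
rewrite big_tuple_cons /=.
under eq_bigr => c _ do rewrite exchange_big /=.
rewrite exchange_big /=.
rewrite (eq_bigr (fun i : 'I_(size ps) => (size (nth [::] ps i))%:R / m.+1%:R)).
  rewrite -mulr_suml -natr_sum -(big_mkord xpredT (fun i => size (nth [::] ps i))).
  rewrite -(big_nth [::] xpredT (@size _)).
  have -> : (\sum_(p <- ps) size p)%N = m.+1.
    by rewrite -sz size_flatten sumnE big_map.
  by rewrite divff // pnatr_eq0.
move=> i _; rewrite -size_flatten sz.
have [nil_i|ne_i] := altP (@nilP _ (nth [::] ps i)).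
  by rewrite nil_i mul0r big1 // => c _; rewrite big1.
case def_i: (rev (nth [::] ps i)) => [|c s].
  by move: ne_i; rewrite /nilp -size_rev def_i.
rewrite (bigD1 c) //= eqxx [X in _ + X]big1 ?addr0; last first.
  move=> x neq_x; rewrite big1 // => t _; case: eqP => // -[e].
  by rewrite e eqxx in neq_x.
rewrite -mulr_sumr IH ?mulr1 //.
have last_i : ohead (rev (nth [::] ps i)) = Some c by rewrite def_i.
have := last_card last_i; move: (take _.-1 _) => q def_q.
rewrite set_nth_split // flatten_cat /= !size_cat.
move: sz; rewrite {1}(nth_split [::] (ltn_ord i)) def_q flatten_cat /= !size_cat.
by rewrite size_rcons addSn addnS => -[].
Qed.

(** The inverse of the multinomial coefficient. *)
Definition riffle_weight (n : nat) (ps : seq (deck n)) : rat :=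
  (\prod_(p <- ps) (size p)`!)%:R / (size (flatten ps))`!%:R.

Lemma drop_riffleE (n : nat) (ps : seq (deck n)) (d : deck n) :
  uniq (flatten ps) ->
  drop_riffle ps d = if interleaving ps d then riffle_weight ps else 0.
Proof. by move=> U; rewrite /drop_riffle drop_probE // revK. Qed.

(** The drop riffle is a probability that is constant on interleavings, so that
    constant is the inverse of their number. *)
Lemma card_interleavings (n : nat) (ps : seq (deck n)) :
  uniq (flatten ps) -> size (flatten ps) = n ->
  (#|[set t : n.-tuple (signed n) | interleaving ps t]|%:R)^-1 = riffle_weight ps.
Proof.
move=> U sz; have := sum_drop_prob sz.
rewrite (reindex (fun t : n.-tuple (signed n) => [tuple of rev t])) /=; last first.
  exists (fun t : n.-tuple (signed n) => [tuple of rev t]) => t _;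
    by apply: val_inj; rewrite /= revK.
rewrite (eq_bigr (fun t : n.-tuple (signed n) =>
                    if interleaving ps t then riffle_weight ps else 0)).
  rewrite -big_mkcond /= sumr_const; set N := #|[set _ | _]|.
  have -> : #|[pred t : n.-tuple (signed n) | interleaving ps t]| = N.
    by rewrite -cardsE.
  move=> one; have {}one : N%:R * riffle_weight ps = 1 by rewrite mulr_natl.
  have N0 : N%:R != 0 :> rat.
    by apply/eqP=> N0; move/eqP: one; rewrite N0 mul0r eq_sym oner_eq0.
  by apply: (mulfI N0); rewrite one mulfV.
by move=> t _; rewrite drop_probE // revK.
Qed.

Lemma uniform_riffleE (n : nat) (ps : seq (deck n)) (d : deck n) :
  uniq (flatten ps) -> size (flatten ps) = n ->
  uniform_riffle ps d = if interleaving ps d then riffle_weight ps else 0.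
Proof. by move=> U sz; rewrite /uniform_riffle card_interleavings. Qed.

(** * Stacks and packets as fibres of a labelling of the cards *)

Lemma reshape_index_homo (sh : seq nat) :
  {homo reshape_index sh : i j / (i <= j)%N}.
Proof. by move=> i j; rewrite (reshape_leq sh i) => /orP[/ltnW|/andP[/eqP ->]]. Qed.

(** As the stacks are cut from an increasing deck, a stack is known from its set
    of cards, and [reshape_index] tells which cards it owns. *)
Lemma nth_reshape_enum (n : nat) (js : seq nat) (i : nat) : sumn js = n ->
  nth [::] (reshape js (enum 'I_n)) i =
  [seq c <- enum 'I_n | reshape_index js (val c) == i].
Proof.
move=> sum_js; set stacks := reshape _ _.
have K : flatten stacks = enum 'I_n by rewrite reshapeKr // size_enum_ord sum_js.
have sh : shape stacks = js by rewrite reshapeKl // size_enum_ord sum_js.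
have U : uniq (flatten stacks) by rewrite K enum_uniq.
(* Card c is at index c of the flattened stacks. *)
have own (c : 'I_n) : c \in nth [::] stacks (reshape_index js c).
  have {1}-> : c = nth c (enum 'I_n) c by rewrite nth_ord_enum.
  rewrite -K nth_flatten sh mem_nth //.
  have -> : size (nth [::] stacks (reshape_index js c)) =
            nth 0%N (shape stacks) (reshape_index js c).
    by rewrite (nth_map [::]) // size_reshape reshape_indexP // sum_js.
  by rewrite sh reshape_offsetP // sum_js.
have sub : subseq (nth [::] stacks i) (enum 'I_n).
  by rewrite nth_reshape (subseq_trans (take_subseq _ _)) ?drop_subseq.
rewrite (subseq_uniqP (enum_uniq _) sub); apply: eq_filter => c.
apply/idP/eqP => [c_i|<- //].
exact: (uniq_flatten_nth U (own c) c_i).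
Qed.

Lemma size_reshape_filter (n : nat) (js : seq nat) (i : nat) : sumn js = n ->
  size [seq c <- enum 'I_n | reshape_index js (val c) == i] = nth 0%N js i.
Proof.
move=> sum_js; rewrite -nth_reshape_enum //.
have sh : shape (reshape js (enum 'I_n)) = js.
  by rewrite reshapeKl // size_enum_ord sum_js.
have [lt_i|le_i] := ltnP i (size js); last by rewrite !nth_default ?size_reshape.
by rewrite -(nth_map [::] 0%N) ?size_reshape // -/(shape _) sh.
Qed.

(** Packets are described by a labelling [f] of the cards rather than by the
    stack sizes: packet [i] holds the cards labelled [i]. *)
Definition packet (n k : nat) (f : 'I_n -> nat) (i : nat) : deck n :=
  let s := [seq c <- enum 'I_n | f c == i] in
  [seq (c, flipped k i.+1) | c <- if flipped k i.+1 then rev s else s].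

Definition packets_by (n k : nat) (f : 'I_n -> nat) : seq (deck n) :=
  [seq packet k f i | i <- iota 0 k].

Lemma packetsE (n : nat) (js : seq nat) : sumn js = n ->
  packets n js = packets_by (size js) (fun c : 'I_n => reshape_index js (val c)).
Proof.
move=> sum_js; apply/eq_in_map => i; rewrite mem_iota add0n /= => lt_i.
rewrite /initial_deck -map_reshape (nth_map [::]) ?size_reshape //.
rewrite nth_reshape_enum // /packet; case: flipped => //.
by rewrite /flip map_rev -!map_comp.
Qed.

Lemma mem_packet (n k : nat) (f : 'I_n -> nat) (i : nat) (x : signed n) :
  (x \in packet k f i) = (f x.1 == i) && (x.2 == flipped k i.+1).
Proof.
case: x => c b /=; apply/mapP/andP => [[c' c'_in [-> ->]]|[fc /eqP ->]].
  split=> //; move: c'_in; case: flipped; rewrite ?mem_rev mem_filter => /andP[] //.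
by exists c => //; case: flipped; rewrite ?mem_rev mem_filter fc mem_enum.
Qed.

Lemma uniq_packet (n k : nat) (f : 'I_n -> nat) (i : nat) : uniq (packet k f i).
Proof.
rewrite map_inj_uniq => [|a b [] //].
by case: flipped; rewrite ?rev_uniq filter_uniq // enum_uniq.
Qed.

Lemma uniq_flatten_map (I T : eqType) (s : seq I) (F : I -> seq T) :
  uniq s -> (forall i, uniq (F i)) ->
  (forall i j x, x \in F i -> x \in F j -> i = j) ->
  uniq (flatten [seq F i | i <- s]).
Proof.
move=> Us UF dis; elim: s Us => //= i s IH /andP[i_s /IH U].
rewrite cat_uniq UF U andbT; apply/hasPn => x /flatten_mapP[j j_s x_j].
by apply: contra i_s => x_i; rewrite (dis _ _ _ x_i x_j).
Qed.

Lemma uniq_packets_by (n k : nat) (f : 'I_n -> nat) :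
  uniq (flatten (packets_by k f)).
Proof.
apply: uniq_flatten_map => [|i|i j x]; rewrite ?iota_uniq ?uniq_packet //.
by rewrite !mem_packet => /andP[/eqP <- _] /andP[/eqP <- _].
Qed.

Lemma mem_packets_by (n k : nat) (f : 'I_n -> nat) (x : signed n) :
  (forall c, f c < k)%N ->
  (x \in flatten (packets_by k f)) = (x.2 == flipped k (f x.1).+1).
Proof.
move=> f_lt; apply/flatten_mapP/eqP => [[i _]|def_x].
  by rewrite mem_packet => /andP[/eqP <- /eqP].
by exists (f x.1); rewrite ?mem_iota ?add0n ?f_lt // mem_packet eqxx def_x eqxx.
Qed.

Lemma size_packets_by (n k : nat) (f : 'I_n -> nat) :
  (forall c, f c < k)%N -> size (flatten (packets_by k f)) = n.
Proof.
move=> f_lt; rewrite -(size_map (fun x : signed n => x.1)) -[RHS]card_ord cardE.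
apply/perm_size/uniq_perm; rewrite ?enum_uniq //.
  rewrite map_inj_in_uniq ?uniq_packets_by // => -[a b] [c d].
  by rewrite !mem_packets_by //= => /eqP -> /eqP -> ->.
move=> c; rewrite mem_enum; apply/mapP.
by exists (c, flipped k (f c).+1); rewrite ?mem_packets_by /=.
Qed.

(** * Interleavings in terms of positions *)

Lemma wapply_neg (n : nat) (w : weylC n) (x : signed n) :
  wapply w (neg x) = neg (wapply w x).
Proof. by have := subgP w; rewrite inE => /forallP/(_ x)/eqP. Qed.

Lemma wapplyK (n : nat) (w : weylC n) : cancel (wapply w) (wapply w^-1%g).
Proof. by move=> x; rewrite /wapply /= permK. Qed.

(** For u the inverse of w, [position u c] is the place of card [c] in the deck
    of w and [face_up u c] tells whether it shows its face there. *)
Definition position (n : nat) (u : weylC n) (c : 'I_n) : 'I_n :=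
  (wapply u (c, false)).1.

Definition face_up (n : nat) (u : weylC n) (c : 'I_n) : bool :=
  (wapply u (c, false)).2.

Lemma wapplyE (n : nat) (u : weylC n) (c : 'I_n) (b : bool) :
  wapply u (c, b) = (position u c, b (+) face_up u c).
Proof.
case: b; last by rewrite /= /position /face_up -surjective_pairing.
by rewrite (wapply_neg u (c, false)).
Qed.

Lemma position_inj (n : nat) (u : weylC n) : injective (position u).
Proof.
move=> c c' eq_p; suff [] : (c, face_up u c) = (c', face_up u c') by [].
by apply: (can_inj (wapplyK u)); rewrite !wapplyE eq_p !addbb.
Qed.

Lemma mem_deck_of (n : nat) (w : weylC n) (x : signed n) :
  (x \in deck_of w) = (x.2 == face_up w^-1%g x.1).
Proof.
have K := wapplyK w; have K' := wapplyK w^-1%g; rewrite invgK in K'.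
case: x => c b /=; apply/mapP/eqP => [[i _ def_x]|->].
  have := K (i, false); rewrite -def_x wapplyE => -[_].
  by case: b {def_x} (face_up _ _) => [] [].
exists (position w^-1%g c); rewrite ?mem_enum //.
by rewrite -[LHS]K' wapplyE addbb.
Qed.

Lemma uniq_deck_of (n : nat) (w : weylC n) : uniq (deck_of w).
Proof.
rewrite map_inj_uniq ?enum_uniq // => i j /(can_inj (wapplyK w)) [] //.
Qed.

(** The order of the cards in the deck of u^-1; the sides on which they lie do
    not matter. *)
Definition above (n : nat) (u : weylC n) : rel (signed n) :=
  fun x y => (position u x.1 < position u y.1)%N.

Lemma above_trans (n : nat) (u : weylC n) : transitive (above u).
Proof. by move=> y x z; apply: ltn_trans. Qed.

Lemma sorted_enum_ord (n : nat) :
  sorted (fun i j : 'I_n => (i < j)%N) (enum 'I_n).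
Proof.
have := iota_ltn_sorted 0 n; rewrite -val_enum_ord sorted_map.
exact: sub_sorted.
Qed.

Lemma deck_of_sorted (n : nat) (w : weylC n) : sorted (above w^-1%g) (deck_of w).
Proof.
rewrite sorted_map; apply: sub_sorted (sorted_enum_ord n) => i j lt_ij.
have pos k : position w^-1%g (wapply w (k, false)).1 = k.
  by have := wapplyK w (k, false); case: (wapply w _) => a b; rewrite wapplyE => -[->].
by rewrite /above /= !pos.
Qed.

(** Sortedness compares neighbours only; transitivity extends it to all pairs,
    and the enumeration being sorted turns indices back into ordinals. *)
Lemma filter_sorted (n : nat) (P : pred 'I_n) (R : rel 'I_n) : transitive R ->
  sorted R [seq c <- enum 'I_n | P c] <->
  (forall a b : 'I_n, P a -> P b -> (a < b)%N -> R a b).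
Proof.
move=> R_tr; set s := filter _ _; pose lt := (fun i j : 'I_n => (i < j)%N).
have lt_tr : transitive lt by move=> j i k; apply: ltn_trans.
have s_lt : sorted lt s by apply: sorted_filter (sorted_enum_ord n).
have s_P a : (a \in s) = P a by rewrite mem_filter mem_enum andbT.
split=> [s_R a b Pa Pb lt_ab|incr].
  apply: (sorted_ltn_index R_tr s_R); rewrite ?s_P //.
  case: (ltngtP (index a s) (index b s)) => // [|eq_i].
    by move/(sorted_ltn_index lt_tr s_lt); rewrite !s_P /lt => /(_ Pb Pa); lia.
  have := congr1 (nth a s) eq_i; rewrite !nth_index ?s_P // => eq_ab.
  by rewrite eq_ab ltnn in lt_ab.
apply: (sub_in_sorted (P := P) (e := lt)) s_lt; last by apply/allP=> a; rewrite s_P.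
by move=> a b; apply: incr.
Qed.

Lemma packet_sorted (n k : nat) (f : 'I_n -> nat) (u : weylC n) (i : nat) :
  sorted (above u) (packet k f i) <->
  (forall a b : 'I_n, f a = i -> f b = i -> (a < b)%N ->
     if flipped k i.+1 then (position u b < position u a)%N
     else (position u a < position u b)%N).
Proof.
rewrite /packet sorted_map; case: flipped; rewrite ?rev_sorted /relpre /above /=.
  rewrite filter_sorted => [|c a b]; last by move=> ? /ltn_trans; apply.
  by split=> H a b; [move/eqP/H => Ha /eqP/Ha|move/eqP/H => Ha /eqP/Ha].
rewrite filter_sorted => [|c a b]; last by apply: ltn_trans.
by split=> H a b; [move/eqP/H => Ha /eqP/Ha|move/eqP/H => Ha /eqP/Ha].
Qed.

(** A packet is a subsequence of the deck exactly when it is sorted for the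
    order of the deck and shows the same sides of its cards.  Flipping reverses
    a packet and turns its cards, which gives the two cases. *)
Lemma interleavingP (n k : nat) (f : 'I_n -> nat) (w : weylC n) :
  (forall c, f c < k)%N ->
  interleaving (packets_by k f) (deck_of w) <->
  (forall c, face_up w^-1%g c = flipped k (f c).+1) /\
  (forall a b : 'I_n, (a < b)%N -> f a = f b ->
     if face_up w^-1%g a then (position w^-1%g b < position w^-1%g a)%N
     else (position w^-1%g a < position w^-1%g b)%N).
Proof.
move=> f_lt; split=> [/andP[pe /allP sub]|[face ord]].
  have face c : face_up w^-1%g c = flipped k (f c).+1.
    apply/eqP; rewrite eq_sym -(mem_deck_of w (c, _)) (perm_mem pe).
    by rewrite mem_packets_by.
  split=> // a b lt_ab eq_f; rewrite face.
  have : subseq (packet k f (f a)) (deck_of w).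
    by apply/sub/map_f; rewrite mem_iota add0n f_lt.
  move/(subseq_sorted (@above_trans n _))/(_ (deck_of_sorted w))/packet_sorted.
  by apply.
apply/andP; split.
  apply: uniq_perm; rewrite ?uniq_deck_of ?uniq_packets_by // => x.
  by rewrite mem_deck_of mem_packets_by // face.
apply/allP=> _ /mapP[i _ ->].
suff -> : packet k f i = [seq x <- deck_of w | f x.1 == i] by apply: filter_subseq.
apply: (irr_sorted_eq (@above_trans n w^-1%g)) => [x|||x].
- exact: ltnn.
- apply/packet_sorted => a b fa fb lt_ab; have := ord a b lt_ab.
  by rewrite face fa fb; apply.
- by apply: sorted_filter (deck_of_sorted w); apply: above_trans.
- by rewrite mem_filter mem_packet mem_deck_of face; case: eqP => [->|].
Qed.

(** * Cyclic descents and walls of the alcove *)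

Lemma ebasisE (n : nat) (c j : 'I_n) : ebasis n c.+1 0 j = (j == c)%:R.
Proof. by rewrite mxE eqSS. Qed.

Lemma signed_vecE (n : nat) (x : signed n) (j : 'I_n) :
  signed_vec x 0 j = if j == x.1 then (-1) ^+ x.2 else 0.
Proof. by rewrite mxE ebasisE; case: eqP; rewrite ?mulr1 ?mulr0. Qed.

Lemma signed_vecN (n : nat) (c : 'I_n) (b : bool) :
  - signed_vec (c, b) = signed_vec (c, ~~ b).
Proof. by apply/rowP=> j; rewrite mxE !signed_vecE /=; case: eqP; case: b. Qed.

Lemma pairing_ebasis (n : nat) (c : 'I_n) (t : 'rV[int]_n) :
  pairing (ebasis n c.+1) t = t 0 c.
Proof.
rewrite /pairing (bigD1 c) //= ebasisE eqxx mul1r big1 ?addr0 // => j /negPf.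
by rewrite ebasisE => ->; rewrite mul0r.
Qed.

Lemma pairingD (n : nat) (v v' t : 'rV[int]_n) :
  pairing (v + v') t = pairing v t + pairing v' t.
Proof. by rewrite -big_split; apply: eq_bigr => i _; rewrite mxE mulrDl. Qed.

Lemma pairingN (n : nat) (v t : 'rV[int]_n) : pairing (- v) t = - pairing v t.
Proof. by rewrite -sumrN; apply: eq_bigr => i _; rewrite mxE mulNr. Qed.

Lemma wactD (n : nat) (u : weylC n) (v v' : 'rV[int]_n) :
  wact u (v + v') = wact u v + wact u v'.
Proof. by rewrite -big_split; apply: eq_bigr => i _; rewrite mxE scalerDl. Qed.

Lemma wactN (n : nat) (u : weylC n) (v : 'rV[int]_n) : wact u (- v) = - wact u v.
Proof. by rewrite -sumrN; apply: eq_bigr => i _; rewrite mxE scaleNr. Qed.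

Lemma wact_ebasis (n : nat) (u : weylC n) (c : 'I_n) :
  wact u (ebasis n c.+1) = signed_vec (position u c, face_up u c).
Proof.
rewrite /wact (bigD1 c) //= ebasisE eqxx scale1r big1 ?addr0 => [|j /negPf].
  by rewrite wapplyE.
by rewrite ebasisE => ->; rewrite scale0r.
Qed.

(** The simplest necessary condition for a root to be positive; it rules out
    the opposites of the positive roots in the two lemmas that follow. *)
Lemma positive_root_lead (n : nat) (v : 'rV[int]_n) (i : 'I_n) :
  positive_root v -> (forall l : 'I_n, (l < i)%N -> v 0 l = 0) -> 0 <= v 0 i.
Proof.
case/orP=> [/existsP[l /eqP ->] _|/existsP[l /existsP[m /andP[lt_lm]]]].
  by rewrite mulr2n mxE ebasisE; case: eqP.
case/orP=> /eqP -> zero; rewrite !mxE !eqSS; first by do 2 case: eqP.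
have [eq_im|_] := eqVneq (val i) m; last by case: eqP.
have := zero l; rewrite !mxE !eqSS eqxx eq_im lt_lm => /(_ isT).
by rewrite (ltn_eqF lt_lm).
Qed.

Lemma positive_root_double (n : nat) (x : signed n) :
  positive_root (signed_vec x *+ 2) = ~~ x.2.
Proof.
case: x => c [] /=; apply/idP; last first.
  apply/orP; left; apply/existsP; exists c.
  by rewrite /signed_vec /= scale1r.
move/(positive_root_lead (i := c)); rewrite mulr2n !mxE eqxx.
suff zero : forall l : 'I_n, (l < c)%N -> (signed_vec (c, true) *+ 2) 0 l = 0.
  by move/(_ zero).
by move=> l lt_lc; rewrite mulr2n mxE !signed_vecE -val_eqE (ltn_eqF lt_lc).
Qed.

Lemma positive_root_pair (n : nat) (x y : signed n) : (x.1 < y.1)%N ->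
  positive_root (signed_vec x + signed_vec y) = ~~ x.2.
Proof.
case: x y => c [] [c' b] /= lt_cc'; apply/idP; last first.
  apply/orP; right; apply/existsP; exists c; apply/existsP; exists c'.
  rewrite lt_cc' /signed_vec /= scale1r.
  by case: b; rewrite ?scaleN1r ?scale1r eqxx ?orbT.
move/(positive_root_lead (i := c)); rewrite mxE !signed_vecE /= eqxx -val_eqE.
rewrite (ltn_eqF lt_cc') addr0 => nonneg.
suff : (0 : int) <= (-1) ^+ true by [].
apply: nonneg => l lt_lc; rewrite mxE !signed_vecE /= -!val_eqE /=.
by rewrite (ltn_eqF lt_lc) (ltn_eqF (ltn_trans lt_lc lt_cc')).
Qed.

(** [descent u c c'] means that u(c) > u(c') in the order
    1 < 2 < ... < n < -n < ... < -1, the one for which e_c - e_(c+1) becomes a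
    negative root when there is a descent at c; see [Cdes_mid]. *)
Definition descent (n : nat) (u : weylC n) (c c' : 'I_n) : bool :=
  if (position u c < position u c')%N then face_up u c else ~~ face_up u c'.

Lemma Cdes0 (n : nat) (u : weylC n) (c : 'I_n) (i : 'I_n.+1) :
  c = 0%N :> nat -> i = 0%N :> nat -> (i \in Cdes u) = ~~ face_up u c.
Proof.
move=> c0 i0; rewrite inE /negative_root /alpha /= i0 /= wactN opprK /theta.
have -> : ebasis n 1 = ebasis n c.+1 by rewrite c0.
by rewrite mulr2n wactD wact_ebasis -mulr2n positive_root_double.
Qed.

Lemma Cdes_last (n : nat) (u : weylC n) (c : 'I_n) (i : 'I_n.+1) :
  c.+1 = n -> i = n :> nat -> (i \in Cdes u) = face_up u c.
Proof.
move=> cn i_n; rewrite inE /negative_root /alpha /= i_n eqxx.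
have -> : (n == 0%N) = false by lia.
have -> : ebasis n n = ebasis n c.+1 by rewrite cn.
rewrite mulr2n wactD wact_ebasis -mulr2n -mulNrn signed_vecN.
by rewrite positive_root_double negbK.
Qed.

Lemma Cdes_mid (n : nat) (u : weylC n) (c c' : 'I_n) (i : 'I_n.+1) :
  c' = c.+1 :> nat -> i = c.+1 :> nat -> (i \in Cdes u) = descent u c c'.
Proof.
move=> c'E iE; have lt_n : (c.+1 < n)%N by rewrite -c'E ltn_ord.
rewrite inE /negative_root /alpha /= iE /= (ltn_eqF lt_n).
have -> : ebasis n c.+2 = ebasis n c'.+1 by rewrite c'E.
rewrite wactD wactN !wact_ebasis opprD opprK signed_vecN /descent.
have neq_p : position u c != position u c' :> nat.
  by apply/eqP=> /val_inj/position_inj e; move: c'E; rewrite e; lia.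
case: ltngtP neq_p => // lt_p _.
  by rewrite positive_root_pair //= negbK.
by rewrite addrC positive_root_pair.
Qed.

(** How far [t] lies inside the half-space bounded by wall [i] of the dilated
    alcove. *)
Definition slack (n k : nat) (t : 'rV[int]_n) (i : 'I_n.+1) : int :=
  if i == ord0 then k%:Z - pairing (theta n) t else pairing (alpha i) t.

Lemma cellini_points_slack (n k : nat) (I : {set 'I_n.+1}) (t : 'rV[int]_n) :
  cellini_points k I t <->
  (forall i, 0 <= slack k t i) /\ I = [set i | slack k t i == 0].
Proof.
split=> [[walls wall0]|[nonneg ->]].
  have sl i : if i \in I then slack k t i = 0 else 0 < slack k t i.
    rewrite /slack; case: eqP => [->|/eqP i0]; last by have := walls i i0.
    by move: wall0; case: ifP => _; lia.
  split=> [i|]; first by have := sl i; case: ifP => _; lia.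
  by apply/setP=> i; rewrite inE; have := sl i; case: ifP => _; lia.
split=> [i /negPf i0|]; rewrite inE; [have := nonneg i|have := nonneg ord0].
  by rewrite /slack i0; case: ifP => [/eqP ->|] //; lia.
by rewrite /slack eqxx; case: ifP; lia.
Qed.

Lemma slack0 (n k : nat) (t : 'rV[int]_n) (c : 'I_n) (i : 'I_n.+1) :
  c = 0%N :> nat -> i = 0%N :> nat -> slack k t i = k%:Z - t 0 c *+ 2.
Proof.
move=> c0 i0; rewrite /slack -val_eqE /= i0 eqxx /theta.
have -> : ebasis n 1 = ebasis n c.+1 by rewrite c0.
by rewrite mulr2n pairingD pairing_ebasis -mulr2n.
Qed.

Lemma slack_last (n k : nat) (t : 'rV[int]_n) (c : 'I_n) (i : 'I_n.+1) :
  c.+1 = n -> i = n :> nat -> slack k t i = t 0 c *+ 2.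
Proof.
move=> cn i_n; rewrite /slack /alpha -val_eqE /= i_n eqxx.
have -> : (n == 0%N) = false by lia.
have -> : ebasis n n = ebasis n c.+1 by rewrite cn.
by rewrite mulr2n pairingD pairing_ebasis -mulr2n.
Qed.

Lemma slack_mid (n k : nat) (t : 'rV[int]_n) (c c' : 'I_n) (i : 'I_n.+1) :
  c' = c.+1 :> nat -> i = c.+1 :> nat -> slack k t i = t 0 c - t 0 c'.
Proof.
move=> c'E iE; have lt_n : (c.+1 < n)%N by rewrite -c'E ltn_ord.
rewrite /slack /alpha -val_eqE /= iE /= (ltn_eqF lt_n) pairingD pairingN.
have -> : ebasis n c.+2 = ebasis n c'.+1 by rewrite c'E.
by rewrite !pairing_ebasis.
Qed.

(** * Labellings and lattice points of the alcove *)

Lemma ord_adjacent (n : nat) (R : rel 'I_n) : transitive R ->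
  (forall c c' : 'I_n, c' = c.+1 :> nat -> R c c') ->
  forall a b : 'I_n, (a < b)%N -> R a b.
Proof.
move=> R_tr adj a [b]; elim: b => //= b IH lt_b; rewrite ltnS leq_eqVlt.
have lt_b' : (b < n)%N by apply: ltnW.
case/orP=> [/eqP eq_ab|/(IH lt_b') ab]; first by apply: adj; rewrite /= eq_ab.
by apply: R_tr ab _; apply: adj.
Qed.

(** Counting the stacks from the last one removes the dependence on the parity
    of [k]. *)
Lemma flippedE (k i : nat) : (i < k)%N -> flipped k i.+1 = odd (k.-1 - i).
Proof.
case: k => // k; rewrite ltnS => le_ik.
by rewrite oddB // /flipped /=; case: odd; case: odd.
Qed.

(** A coordinate of value t stands for the stacks, if any, whose indices counted
    from the end are 2 t - 1, which is flipped, and 2 t, which is not. *)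
Definition alcove_point (n k : nat) (f : {ffun 'I_n -> 'I_k}) : 'rV[int]_n :=
  \row_c (uphalf (k.-1 - f c))%:Z.

Definition face_compatible (n k : nat) (u : weylC n) (f : {ffun 'I_n -> 'I_k}) :=
  [forall c, face_up u c == flipped k (f c).+1].

Lemma alcove_point_double (n k : nat) (u : weylC n) (f : {ffun 'I_n -> 'I_k}) :
  face_compatible u f ->
  forall c, alcove_point f 0 c *+ 2 = k%:Z - 1 - (f c)%:Z + (face_up u c)%:Z.
Proof.
move=> /forallP face c; rewrite mxE (eqP (face c)) flippedE //.
have := odd_double_half (k.-1 - f c); have := ltn_ord (f c).
by rewrite uphalf_half -muln2; case: odd => /=; lia.
Qed.

(** The rounding in [alcove_point] loses only the parity of the label, which
    compatibility with [u] restores. *)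
Lemma alcove_point_inj (n k : nat) (u : weylC n) :
  {in face_compatible (k := k) u &, injective (@alcove_point n k)}.
Proof.
move=> f f' cf cf' eq_t; apply/ffunP=> c; apply: val_inj => /=.
have := alcove_point_double cf c; rewrite eq_t (alcove_point_double cf').
by lia.
Qed.

(** The points of the closed dilated alcove that avoid the walls indexed by the
    cyclic descents of [u]; slacks being integers, avoiding a wall means that
    the slack is at least 1. *)
Definition above_walls (n k : nat) (u : weylC n) (t : 'rV[int]_n) :=
  [forall i : 'I_n.+1, (i \in Cdes u)%:Z <= slack k t i].

Lemma above_wallsP (n k : nat) (u : weylC n) (t : 'rV[int]_n) : (0 < n)%N ->
  reflect
    [/\ forall c : 'I_n, c = 0%N :> nat -> (~~ face_up u c)%:Z <= k%:Z - t 0 c *+ 2,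
        forall c c' : 'I_n, c' = c.+1 :> nat -> (descent u c c')%:Z <= t 0 c - t 0 c'
      & forall c : 'I_n, c.+1 = n -> (face_up u c)%:Z <= t 0 c *+ 2]
    (above_walls k u t).
Proof.
move=> n_gt0; apply: (iffP forallP) => [walls|[wall0 wall_mid wall_last] i].
  split=> [c c0|c c' adj|c c_last].
  - by have := walls ord0; rewrite (Cdes0 u c0) // (slack0 k t c0).
  - have lt_c : (c.+1 < n.+1)%N by rewrite ltnS.
    by have := walls (Ordinal lt_c); rewrite (Cdes_mid u adj) // (slack_mid k t adj).
  - by have := walls ord_max; rewrite (Cdes_last u c_last) // (slack_last k t c_last).
have [i0|i_gt0] := posnP i.
  pose c := Ordinal n_gt0.
  by rewrite (Cdes0 u (c := c)) // (slack0 k t (c := c)) // wall0.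
have lt_c : (i.-1 < n)%N by have := ltn_ord i; lia.
have [i_n|lt_in] := eqVneq (i : nat) n.
  have c_last : (Ordinal lt_c).+1 = n by rewrite /=; lia.
  by rewrite (Cdes_last u c_last) // (slack_last k t c_last) // wall_last.
have lt_c' : (i < n)%N by have := ltn_ord i; lia.
have adj : Ordinal lt_c' = (Ordinal lt_c).+1 :> nat by rewrite /= prednK.
by rewrite (Cdes_mid u adj) // (slack_mid k t adj) // wall_mid.
Qed.

(** The end walls come for free from 0 <= f < k.  For an inner wall, twice the
    slack is f(c') - f(c) plus the difference of the signs.  When the signs
    differ, whether there is a descent is determined by them, and parity makes
    up for the difference. *)
Lemma above_walls_alcove_point (n k : nat) (u : weylC n) (f : {ffun 'I_n -> 'I_k}) :
  (0 < n)%N -> face_compatible u f ->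
  above_walls k u (alcove_point f) <->
  (forall c c' : 'I_n, c' = c.+1 :> nat -> (f c + descent u c c' <= f c')%N).
Proof.
move=> n_gt0 face; have dbl := alcove_point_double face.
split=> [/(above_wallsP k u _ n_gt0)[_ walls _] c c' adj|adj].
  have := walls c c' adj; have := dbl c; have := dbl c'; rewrite /descent.
  by case: ltnP => _; case: face_up; case: face_up => /=; lia.
apply/above_wallsP => //; split=> [c _|c c' /adj|c _].
- by have := dbl c; case: face_up => /=; lia.
- have := dbl c; have := dbl c'; rewrite /descent.
  by case: ltnP => _; case: face_up; case: face_up => /=; lia.
- by have := dbl c; have := ltn_ord (f c); case: face_up => /=; lia.
Qed.

(** The label is forced: k - 1 - (2 t(c) - b(c)).  The inner walls make it
    monotone in c, so that the end walls suffice to keep it in range. *)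
Lemma alcove_point_onto (n k : nat) (u : weylC n) (t : 'rV[int]_n) :
  (0 < n)%N -> (0 < k)%N -> above_walls k u t ->
  exists2 f : {ffun 'I_n -> 'I_k}, face_compatible u f & alcove_point f = t.
Proof.
move=> n_gt0 k_gt0 /(above_wallsP k u _ n_gt0)[wall0 wall_mid wall_last].
(* What the index of the stack of card c, counted from the end, has to be. *)
pose G c : int := t 0 c *+ 2 - (face_up u c)%:Z.
have G_mono : forall a b : 'I_n, (a < b)%N -> G b <= G a.
  apply: ord_adjacent => [b a c ba cb|c c' /wall_mid]; first exact: le_trans cb ba.
  rewrite /G /descent.
  by case: ltnP => _; case: face_up; case: face_up => /=; lia.
have G_ge0 c : 0 <= G c.
  have lt_l : (n.-1 < n)%N by lia.
  have := wall_last (Ordinal lt_l); rewrite /= prednK // => /(_ erefl) last_ge0.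
  have [c_l|] := eqVneq c (Ordinal lt_l); first by rewrite c_l /G; lia.
  rewrite -val_eqE /= => c_l; apply: le_trans (G_mono c (Ordinal lt_l) _).
    by rewrite /G; lia.
  by rewrite /=; have := ltn_ord c; lia.
have G_lt c : G c < k%:Z.
  have := wall0 (Ordinal n_gt0) erefl => first_lt.
  have first : G (Ordinal n_gt0) < k%:Z.
    by move: first_lt; rewrite /G; case: face_up => /=; lia.
  have [c0|c_gt0] := posnP c.
    by rewrite (_ : c = Ordinal n_gt0) //; apply: val_inj.
  by apply: le_lt_trans first; apply: G_mono.
pose f : {ffun 'I_n -> 'I_k} :=
  [ffun c => insubd (Ordinal k_gt0) (absz (k%:Z - 1 - G c)%R)].
have fE c : (f c)%:Z = k%:Z - 1 - G c.
  rewrite ffunE val_insubd; have := G_ge0 c; have := G_lt c.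
  by case: ifP; lia.
have face : face_compatible u f.
  apply/forallP=> c; apply/eqP; rewrite flippedE //.
  have := fE c; have := ltn_ord (f c); rewrite /G.
  by case: face_up => /=; lia.
exists f => //; apply/rowP=> c.
by have := alcove_point_double face c; rewrite fE /G; lia.
Qed.

(** * Counting *)

Definition compatible_labels (n k : nat) (u : weylC n) :
    {set {ffun 'I_n -> 'I_k}} :=
  [set f | face_compatible u f & above_walls k u (alcove_point f)].

(** A lattice point counts in a_(k,I) when [I] is the set of the walls through
    it, so different [I] count disjoint sets of points. *)
Lemma cellini_aE (n k : nat) (u : weylC n) (I : {set 'I_n.+1}) :
  (0 < n)%N -> (0 < k)%N -> I \subset ~: Cdes u ->
  cellini_a k I =
  #|[set f in compatible_labels k u
      | [set i | slack k (alcove_point f) i == 0] == I]|.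
Proof.
move=> n_gt0 k_gt0 /fintype.subsetP I_sub; set A := [set f in _ | _].
rewrite /cellini_a.
have -> : cellini_points k I = [set` [fset alcove_point f | f in A]%fset]%classic.
  apply/seteqP; split=> t.
    move=> /cellini_points_slack[nonneg def_I].
    have above : above_walls k u t.
      apply/forallP=> i; case i_des : (i \in Cdes u); last exact: nonneg.
      have : i \notin I by apply: contraTN i_des => /I_sub; rewrite inE.
      by rewrite def_I inE; have := nonneg i; lia.
    have [f face def_t] := alcove_point_onto n_gt0 k_gt0 above.
    apply/imfsetP; exists f => //=.
    by rewrite !inE face def_t above -def_I eqxx.
  case/imfsetP=> f /=; rewrite !inE => /andP[/andP[_ /forallP above] /eqP <-] ->.
  apply/cellini_points_slack; split=> // i.
  by apply: le_trans (above i); case: (i \in _).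
rewrite set_fsetK card_in_imfset /=; first by rewrite -cardE.
move=> f f'; rewrite !inE => /andP[/andP[face _] _] /andP[/andP[face' _] _].
exact: (alcove_point_inj face face').
Qed.

Lemma cellini_xE (n k : nat) (u : weylC n) : (0 < n)%N -> (0 < k)%N ->
  cellini_x n k u = #|compatible_labels k u|%:R / k%:R ^+ n.
Proof.
move=> n_gt0 k_gt0; rewrite ffunE mulrC; congr (_ / _).
rewrite -natr_sum; congr _%:R.
pose walls (f : {ffun 'I_n -> 'I_k}) := [set i | slack k (alcove_point f) i == 0].
rewrite -sum1_card (partition_big walls (fun I => I \subset ~: Cdes u)) /=.
  apply: eq_bigr => I I_sub; rewrite (cellini_aE n_gt0 k_gt0 I_sub) -sum1_card.
  by apply: eq_bigl => f; rewrite inE.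
move=> f; rewrite inE => /andP[_ /forallP above]; apply/fintype.subsetP=> i.
rewrite !inE => /eqP on_wall; have := above i; rewrite on_wall inE.
by case: negative_root.
Qed.

Lemma packets_by_eq (n k : nat) (f f' : 'I_n -> nat) :
  f =1 f' -> packets_by k f = packets_by k f'.
Proof.
move=> eq_f; apply: eq_map => i; rewrite /packet.
by rewrite (eq_filter (a2 := fun c => f' c == i)) // => c; rewrite eq_f.
Qed.

(** The conditions at adjacent cards amount to comparing all pairs of cards
    lexicographically, by label first and by place in the deck next. *)
Lemma compatible_labelsP (n k : nat) (w : weylC n) (f : {ffun 'I_n -> 'I_k}) :
  (0 < n)%N ->
  f \in compatible_labels k w^-1%g <->
  {homo f : a b / (a <= b)%N} /\
  interleaving (packets_by k (fun c => nat_of_ord (f c))) (deck_of w).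
Proof.
move=> n_gt0; set u := w^-1%g; rewrite inE.
have face_iff : face_compatible u f <-> forall c, face_up u c = flipped k (f c).+1.
  by split=> [/forallP face c|face]; [apply/eqP|apply/forallP=> c; apply/eqP].
have int_iff :=
  interleavingP w (f := fun c => nat_of_ord (f c)) (fun c => ltn_ord (f c)).
rewrite -/u in int_iff.
split=> [/andP[face]|[mono /int_iff[/face_iff face order]]].
  move/(above_walls_alcove_point n_gt0 face) => adj.
  have /face_iff faceE := face.
  (* The lexicographic order on labels, then on places within a packet. *)
  pose R : rel 'I_n := fun a b => (f a < f b)%N || ((f a == f b) &&
    (if face_up u a then (position u b < position u a)%N
     else (position u a < position u b)%N)).
  have R_lt : forall a b : 'I_n, (a < b)%N -> R a b.
    apply: ord_adjacent => [b a c|c c' next].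
      rewrite /R !faceE => /orP[ab|/andP[/eqP -> ab]] /orP[bc|/andP[/eqP <- bc]].
      - by rewrite (ltn_trans ab bc).
      - by rewrite ab.
      - by rewrite bc.
      - by rewrite eqxx; apply/orP; right; move: ab bc; case: flipped => /=; lia.
    have := adj c c' next; rewrite /R /descent.
    have [eq_f|neq_f] := eqVneq (f c) (f c'); last first.
      by move: neq_f; rewrite -val_eqE /=; lia.
    rewrite eq_f !faceE eq_f ltnn /=.
    have neq_p : position u c != position u c' :> nat.
      by apply/eqP=> /val_inj/position_inj e; move: next; rewrite e; lia.
    by case: ltngtP neq_p => //; case: flipped => //=; lia.
  split=> [a b|].
    rewrite leq_eqVlt => /orP[/eqP/val_inj -> //|/R_lt].
    by case/orP=> [/ltnW|/andP[/eqP -> _]].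
  apply/int_iff; split=> // a b lt_ab eq_f; have := R_lt a b lt_ab.
  by rewrite /R -val_eqE /= eq_f ltnn eqxx.
rewrite face; apply/(above_walls_alcove_point n_gt0 face) => c c' next.
have lt_c : (c < c')%N by rewrite next.
have := mono c c' (ltnW lt_c); rewrite leq_eqVlt.
case/orP=> [/eqP eq_f|lt_f]; last first.
  by apply: leq_trans lt_f; rewrite -addn1 leq_add2l leq_b1.
have := order c c' lt_c eq_f; have /face_iff faceE := face.
rewrite /descent !faceE -eq_f.
case: flipped => /= lt_p; last by rewrite lt_p addn0.
by rewrite ltnNge (ltnW lt_p) addn0.
Qed.

Definition stack_sizes (n k : nat) (f : 'I_n -> nat) : k.-tuple 'I_n.+1 :=
  [tuple inord (size [seq c <- enum 'I_n | f c == i]) | i < k].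

Lemma val_stack_sizes (n k : nat) (f : 'I_n -> nat) :
  map val (stack_sizes k f) =
  [seq size [seq c <- enum 'I_n | f c == i] | i <- iota 0 k].
Proof.
rewrite /= -map_comp -val_enum_ord -[RHS]map_comp; apply: eq_map => i /=.
by rewrite inordK // ltnS -[X in (_ <= X)%N]size_enum_ord size_filter count_size.
Qed.

Lemma size_packet (n k : nat) (f : 'I_n -> nat) (i : nat) :
  size (packet k f i) = size [seq c <- enum 'I_n | f c == i].
Proof. by rewrite size_map; case: flipped; rewrite ?size_rev. Qed.

Lemma sumn_stack_sizes (n k : nat) (f : 'I_n -> nat) :
  (forall c, f c < k)%N -> sumn (map val (stack_sizes k f)) = n.
Proof.
move=> f_lt; rewrite val_stack_sizes -[RHS](size_packets_by f_lt) size_flatten.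
by rewrite /shape -map_comp; congr sumn; apply: eq_map => i; rewrite /= size_packet.
Qed.

Lemma nth_stack_sizes (n k : nat) (f : 'I_n -> nat) (i : nat) :
  (forall c, f c < k)%N ->
  nth 0%N (map val (stack_sizes k f)) i = size [seq c <- enum 'I_n | f c == i].
Proof.
move=> f_lt; rewrite val_stack_sizes; have [lt_i|le_i] := ltnP i k.
  by rewrite (nth_map 0%N) ?size_iota // nth_iota.
rewrite nth_default ?size_map ?size_iota //; apply/esym/eqP.
rewrite size_filter -leqn0 leqNgt -has_count; apply/hasPn => c _.
by have := f_lt c; lia.
Qed.

(** A monotone labelling is determined by the sizes of its fibres, since a
    sorted sequence is determined by its multiset of entries. *)
Lemma reshape_index_stack_sizes (n k : nat) (f : 'I_n -> nat) :
  (forall c, f c < k)%N -> {homo f : a b / (a <= b)%N} ->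
  forall c : 'I_n, reshape_index (map val (stack_sizes k f)) c = f c.
Proof.
move=> f_lt mono; set js := map val _.
have sorted_of (g : 'I_n -> nat) : {homo g : a b / (a <= b)%N} ->
    sorted leq [seq g c | c <- enum 'I_n].
  move=> g_mono; rewrite sorted_map; apply: sub_sorted (sorted_enum_ord n) => a b.
  by move/ltnW/g_mono.
have eq_seq : [seq reshape_index js (val c) | c <- enum 'I_n] =
              [seq f c | c <- enum 'I_n].
  apply: (sorted_eq leq_trans anti_leq).
  - by apply: sorted_of => a b; apply: reshape_index_homo.
  - exact: sorted_of.
  apply/allP=> i _; rewrite inE (count_map f) (count_map _ _ (enum _)); apply/eqP.
  have := size_reshape_filter i (sumn_stack_sizes f_lt).
  by rewrite nth_stack_sizes // !size_filter.
by move=> c; move/eq_in_map: eq_seq => /(_ c); rewrite mem_enum => ->.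
Qed.

Definition compatible_sizes (n k : nat) (w : weylC n) : {set k.-tuple 'I_n.+1} :=
  [set j : k.-tuple 'I_n.+1 | sumn (map val j) == n
         & interleaving (packets n (map val j)) (deck_of w)].

(** Stack sizes correspond to monotone labellings, through [reshape_index] one
    way and the sizes of the fibres the other way. *)
Lemma card_compatible_sizes (n k : nat) (w : weylC n) : (0 < n)%N -> (0 < k)%N ->
  #|compatible_sizes k w| = #|compatible_labels k w^-1%g|.
Proof.
move=> n_gt0 k_gt0.
pose sizes (f : {ffun 'I_n -> 'I_k}) := stack_sizes k (fun c => nat_of_ord (f c)).
have f_lt (f : {ffun 'I_n -> 'I_k}) c : (f c < k)%N by [].
rewrite -(card_in_imset (f := sizes)) => [|f f']; last first.
  move=> /(compatible_labelsP _ _ n_gt0)[mono _].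
  move=> /(compatible_labelsP _ _ n_gt0)[mono' _] eq_s.
  apply/ffunP=> c; apply: val_inj => /=.
  rewrite -(reshape_index_stack_sizes (f_lt f) mono) -/(sizes f) eq_s.
  by rewrite reshape_index_stack_sizes.
apply: eq_card => j; rewrite inE; apply/andP/imsetP => [[/eqP sum_j inter]|[f]].
  have lt_j (c : 'I_n) : (reshape_index (map val j) c < k)%N.
    by have := @reshape_indexP (map val j) c; rewrite size_map size_tuple sum_j; apply.
  pose f : {ffun 'I_n -> 'I_k} := [ffun c => Ordinal (lt_j c)].
  have fE c : f c = reshape_index (map val j) c :> nat by rewrite ffunE.
  exists f.
    apply/compatible_labelsP => //; split=> [a b le_ab|].
      by rewrite !fE reshape_index_homo.
    by move: inter; rewrite packetsE // size_map size_tuple (packets_by_eq k fE).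
  apply/val_inj/(inj_map val_inj)/(@eq_from_nth _ 0%N).
    by rewrite (size_map _ (val j)) (size_map _ (val (sizes f))) !size_tuple.
  move=> i _; rewrite nth_stack_sizes // -(size_reshape_filter _ sum_j).
  by congr size; apply: eq_filter => c; rewrite fE.
move=> /(compatible_labelsP _ _ n_gt0)[mono inter] ->.
have sum_f := sumn_stack_sizes (f_lt f); split; first by rewrite sum_f.
rewrite packetsE // size_map size_tuple
  (packets_by_eq k (f' := fun c => nat_of_ord (f c))) //.
by apply: reshape_index_stack_sizes.
Qed.

Lemma riffle_weight_packets (n : nat) (js : seq nat) : sumn js = n ->
  riffle_weight (packets n js) = (\prod_(j <- js) j`!)%:R / n`!%:R.
Proof.
move=> sum_js; rewrite packetsE // /riffle_weight.
have lt_js (c : 'I_n) : (reshape_index js c < size js)%N.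
  by apply: reshape_indexP; rewrite sum_js.
rewrite size_packets_by //; congr (_%:R / _).
rewrite big_map [RHS](big_nth 0%N) /index_iota subn0; apply: eq_bigr => i _.
by rewrite size_packet size_reshape_filter.
Qed.

(** The multinomial coefficient is cancelled by the weight of an interleaving,
    so each admissible choice of stack sizes contributes 1 / k^n. *)
Lemma shuffle_probE (n k : nat) (riffle : seq (deck n) -> deck n -> rat)
    (w : weylC n) : (0 < n)%N -> (0 < k)%N ->
  (forall ps d, uniq (flatten ps) -> size (flatten ps) = n ->
     riffle ps d = if interleaving ps d then riffle_weight ps else 0) ->
  shuffle_prob k riffle w = ga_inv (cellini_x n k) w.
Proof.
move=> n_gt0 k_gt0 riffleE; rewrite ffunE cellini_xE // -card_compatible_sizes //.
rewrite mulr_natl -sumr_const /shuffle_prob [LHS]big_mkcond [RHS]big_mkcond /=.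
apply: eq_bigr => j _.
rewrite inE; case: eqP => //= sum_j.
have lt_j (c : 'I_n) : (reshape_index (map val j) c < size (map val j))%N.
  by apply: reshape_indexP; rewrite sum_j.
rewrite riffleE; last first.
- by rewrite packetsE // size_packets_by.
- by rewrite packetsE // uniq_packets_by.
case: ifP => _; last by rewrite mulr0.
rewrite riffle_weight_packets // /multinomial_prob mulrAC mulrA divfK; last first.
  rewrite pnatr_eq0 -lt0n; elim/big_ind: _ => // [x y x_gt0 y_gt0|i _].
    by rewrite muln_gt0 x_gt0.
  exact: fact_gt0.
by rewrite divff ?mul1r // pnatr_eq0 -lt0n fact_gt0.
Qed.

Theorem proposition2 (n k : nat) (hn : (1 <= n)%N) (hk : (1 <= k)%N) :
  (forall w : weylC n,
     ga_inv (cellini_x n k) w = shuffle_prob k (@drop_riffle n) w) /\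
  (forall w : weylC n,
     ga_inv (cellini_x n k) w = shuffle_prob k (@uniform_riffle n) w).
Proof.
split=> w; rewrite shuffle_probE // => ps d U sz.
  exact: drop_riffleE.
exact: uniform_riffleE.
Qed.
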